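(* For each of the two infeasible iterative refinement (IR) methods described in the context (the one using an infeasible non-interior oracle and the one using an infeasible interior oracle), the IR method returns an $\tilde\epsilon$-optimal solution of the SDO problem after at most $$\mathcal O\left(\frac{\log(\tilde\epsilon)}{\log(\epsilon)}\right)$$ iterations.
   Context: $\mathcal S^n$ is the space of real symmetric $n\times n$ matrices, $U\bullet V=\mathrm{tr}(UV)$, $e_{\min}$ denotes the smallest eigenvalue, and $U\succeq V$ means that $U-V$ is positive semidefinite. The semidefinite optimization (SDO) problem, with data $b\in\mathbb R^m$ and $C,A_1,\dots,A_m\in\mathcal S^n$ ($A_1,\dots,A_m$ linearly independent), is the primal-dual pair (P) $\inf_X\{C\bullet X: A_i\bullet X=b_i\ (i=1,\dots,m),\ X\succeq0\}$ and (D) $\sup_{y,S}\{b^\top y:\sum_i y_iA_i+S=C,\ S\succeq0\}$, with $X,S\in\mathcal S^n$, $y\in\mathbb R^m$. Strong duality (zero duality gap) is assumed. The input of each method consists of the problem data, error tolerances $0<\tilde\epsilon\ll\epsilon<1$, where $\epsilon$ is the precision to which the oracle is called and $\tilde\epsilon$ is the target precision, a strictly feasible point $(X^{(0)},y^{(0)},S^{(0)})$ of (P)-(D), and an incremental scaling limit $\rho\in\mathbb N$, $\rho>1$. The stated output of each method is an $\tilde\epsilon$-precise solution of (P)-(D), in the sense defined below for that method; this is the $\tilde\epsilon$-optimal solution of the claim. Method 1 (infeasible non-interior oracle). $(X,y,S)$ is $\epsilon$-precise for (P)-(D) if $e_{\min}(X)\ge-\epsilon$, $e_{\min}(S)\ge-\epsilon$,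 $S=C-\sum_iy_iA_i$, $\max_i|b_i-A_i\bullet X|\le\epsilon$ and $X\bullet S\le\epsilon$. For given $X$, $y$ and scaling factor $\eta$, with $S=C-\sum_iy_iA_i$ and $\bar b_i=b_i-A_i\bullet X$, the refining pair is $\min_{\bar X\in\mathcal S^n}\{\eta S\bullet\bar X: A_i\bullet\bar X=\eta\bar b_i\ (i=1,\dots,m),\ \bar X\succeq-\eta X\}$ and $\max_{\bar y,\bar S}\{\eta\bar b^\top\bar y-\eta X\bullet\bar S:\sum_i\bar y_iA_i+\bar S=\eta S,\ \bar S\succeq0\}$. A triple $(\bar X,\bar y,\bar S)$ is $\epsilon$-precise for the refining pair if $e_{\min}(\bar X+\eta X)\ge-\epsilon$, $\bar S=\eta S-\sum_i\bar y_iA_i$, $e_{\min}(\bar S)\ge-\epsilon$, $|\eta\bar b_i-A_i\bullet\bar X|\le\epsilon$ for all $i$, and $(\bar X+\eta X)\bullet\bar S\le\epsilon$. The residual of an iterate is $r=\max\{\max_i|\bar b_i|,\ X\bullet S,\ \max\{-e_{\min}(X),0\},\ \max\{-e_{\min}(S),0\}\}$. The dual slack update is $S^{(k+1)}=C-\sum_iy_i^{(k+1)}A_i$. Method 2 (infeasible interior oracle). $(X,y,S)$ is $\epsilon$-precise for (P)-(D) if $X\succeq0$, $S\succeq0$, $\|\bar C\|\le\epsilon$, $\|\bar b\|\le\epsilon$ and $X\bullet S\le\epsilon$, where $\bar C=C-\sum_iy_iA_i-S$, $\bar b_i=b_i-A_i\bullet X$, $\|\bar b\|=\max_i|\bar b_i|$,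 and $\|\bar C\|$ is a fixed matrix norm. For given $X,y,S$ and scaling factor $\eta$, the refining pair is $\min_{\bar X\in\mathcal S^n}\{\eta(\bar C+S)\bullet\bar X: A_i\bullet\bar X=\eta\bar b_i\ (i=1,\dots,m),\ \bar X\succeq-\eta X\}$ and $\max_{\bar y,\bar S}\{\eta\bar b^\top\bar y-\eta X\bullet(\bar S+\eta S):\sum_i\bar y_iA_i+\bar S=\eta\bar C,\ \bar S\succeq-\eta S\}$. A triple $(\bar X,\bar y,\bar S)$ is $\epsilon$-precise for the refining pair if $\bar X+\eta X\succeq0$, $\bar S+\eta S\succeq0$, $\|\eta\bar C-\sum_i\bar y_iA_i-\bar S\|\le\epsilon$, $|\eta\bar b_i-A_i\bullet\bar X|\le\epsilon$ for all $i$, and $(\bar X+\eta X)\bullet(\bar S+\eta S)\le\epsilon$. The residual of an iterate is $r=\max\{\max_i|\bar b_i|,\ X\bullet S,\ \|\bar C\|\}$. The dual slack update is $S^{(k+1)}=S^{(k)}+\frac1{\eta^{(k)}}\bar S$. Both methods run as follows. Set $\eta^{(1)}=1$, $k=1$, and let $(X^{(1)},y^{(1)},S^{(1)})$ be an $\epsilon$-precise solution of (P)-(D) returned by the oracle. While $X^{(k)}\bullet S^{(k)}>\tilde\epsilon$: compute the residual $r^{(k)}$ of $(X^{(k)},y^{(k)},S^{(k)})$; set $\eta^{(k+1)}=\min\{1/r^{(k)},\ \rho\,\eta^{(k)}\}$; obtain from the oracle an $\epsilon$-precise solution $(\bar X,\bar y,\bar S)$ of the refining pair at $(X^{(k)},y^{(k)},S^{(k)})$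 with scaling factor $\eta=\eta^{(k)}$; set $X^{(k+1)}=X^{(k)}+\frac1{\eta^{(k)}}\bar X$ and $y^{(k+1)}=y^{(k)}+\frac1{\eta^{(k)}}\bar y$, and perform the dual slack update; replace $k$ by $k+1$.
   Formalization: The loop as described, stopping at X•S≤ε̃, can return a point that is not ε̃-precise: for it the bound is proved, with ε̃-precision only if the residual r≤ε̃; the full claim is proved for the loop run while r>ε̃. The O-constant depends on an upper bound for log_ρ(1/ε). *)

(* Defs.v *)
From mathcomp Require Import all_boot all_order all_algebra.
From mathcomp Require Import all_classical all_reals all_analysis.

Set Implicit Arguments.
Unset Strict Implicit.
Unset Printing Implicit Defensive.

Import Order.TTheory GRing.Theory Num.Theory.
Local Open Scope classical_set_scope.
Local Open Scope ring_scope.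

Definition mxip (R : realType) (n : nat) (U V : 'M[R]_n) : R := \tr (U *m V).

(* For a symmetric matrix of size n > 0 the set is finite and nonempty, so this
   infimum is the smallest eigenvalue. *)
Definition emin (R : realType) (n : nat) (U : 'M[R]_n) : R :=
  inf [set a : R | eigenvalue U a].

Definition psd (R : realType) (n : nat) (U : 'M[R]_n) : Prop :=
  U \is symmetricmx /\ forall x : 'cV[R]_n, 0 <= (x^T *m U *m x) 0 0.

Definition posdef (R : realType) (n : nat) (U : 'M[R]_n) : Prop :=
  U \is symmetricmx /\
  forall x : 'cV[R]_n, x != 0 -> 0 < (x^T *m U *m x) 0 0.

Definition maxnorm (R : realType) (m : nat) (v : 'cV[R]_m) : R :=
  \big[Num.max/0]_(i < m) `|v i 0|.

Record is_matrix_norm (R : realType) (n : nat) (N : 'M[R]_n -> R) : Prop :=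
  IsMatrixNorm {
    matrix_norm_eq0 : forall U, N U = 0 -> U = 0;
    matrix_normZ : forall a U, N (a *: U) = `|a| * N U;
    matrix_norm_triangle : forall U V, N (U + V) <= N U + N V
  }.

Record sdo (R : realType) (m n : nat) := Sdo {
  sdoC : 'M[R]_n;
  sdoA : 'I_m -> 'M[R]_n;
  sdob : 'cV[R]_m
}.

Record triple (R : realType) (m n : nat) := Triple {
  tX : 'M[R]_n;
  ty : 'cV[R]_m;
  tS : 'M[R]_n
}.

Definition sdo_data_ok (R : realType) (m n : nat) (P : sdo R m n) : Prop :=
  [/\ sdoC P \is symmetricmx, forall i, sdoA P i \is symmetricmx
    & free [tuple sdoA P i | i < m]].

Definition lincomb (R : realType) (m n : nat) (P : sdo R m n) (y : 'cV[R]_m) :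
  'M[R]_n := \sum_(i < m) y i 0 *: sdoA P i.

Definition slack (R : realType) (m n : nat) (P : sdo R m n) (y : 'cV[R]_m) :
  'M[R]_n := sdoC P - lincomb P y.

Definition bbar (R : realType) (m n : nat) (P : sdo R m n) (X : 'M[R]_n) :
  'cV[R]_m := \col_i (sdob P i 0 - mxip (sdoA P i) X).

Definition Cbar (R : realType) (m n : nat) (P : sdo R m n) (y : 'cV[R]_m)
  (S : 'M[R]_n) : 'M[R]_n := sdoC P - lincomb P y - S.

Definition primal_feasible (R : realType) (m n : nat) (P : sdo R m n)
  (X : 'M[R]_n) : Prop :=
  psd X /\ forall i, mxip (sdoA P i) X = sdob P i 0.

Definition dual_feasible (R : realType) (m n : nat) (P : sdo R m n)
  (y : 'cV[R]_m) : Prop :=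
  exists S : 'M[R]_n, psd S /\ lincomb P y + S = sdoC P.

Definition strong_duality (R : realType) (m n : nat) (P : sdo R m n) : Prop :=
  ereal_inf [set (mxip (sdoC P) X)%:E | X in [set X | primal_feasible P X]] =
  ereal_sup [set (((sdob P)^T *m y) 0 0)%:E | y in [set y | dual_feasible P y]].

Definition strictly_feasible (R : realType) (m n : nat) (P : sdo R m n)
  (z : triple R m n) : Prop :=
  [/\ posdef (tX z), forall i, mxip (sdoA P i) (tX z) = sdob P i 0,
      posdef (tS z) & lincomb P (ty z) + tS z = sdoC P].

(* The ingredients in which the two methods differ:
   - [precise e z]: z is an e-precise solution of (P)-(D);
   - [refining_precise eta e z zb]: zb is an e-precise solution of the refining
     pair at z with scaling factor eta;
   - [residual z];
   - [dual_update eta z zb y']: the new S, where y' is the already updated y. *)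
Record ir_method (R : realType) (m n : nat) := IRMethod {
  precise : R -> triple R m n -> Prop;
  refining_precise : R -> R -> triple R m n -> triple R m n -> Prop;
  residual : triple R m n -> R;
  dual_update : R -> triple R m n -> triple R m n -> 'cV[R]_m -> 'M[R]_n
}.

Definition noninterior_method (R : realType) (m n : nat) (P : sdo R m n) :
  ir_method R m n :=
  {| precise := fun e z =>
       [/\ tX z \is symmetricmx, - e <= emin (tX z) & - e <= emin (tS z)] /\
       [/\ tS z = slack P (ty z), maxnorm (bbar P (tX z)) <= e
         & mxip (tX z) (tS z) <= e];
     refining_precise := fun eta e z zb =>
       [/\ tX zb \is symmetricmx, - e <= emin (tX zb + eta *: tX z),
           tS zb = eta *: slack P (ty z) - lincomb P (ty zb)
         & - e <= emin (tS zb)] /\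
       (forall i,
          `|eta * bbar P (tX z) i 0 - mxip (sdoA P i) (tX zb)| <= e) /\
       mxip (tX zb + eta *: tX z) (tS zb) <= e;
     residual := fun z =>
       Num.max (Num.max (maxnorm (bbar P (tX z))) (mxip (tX z) (tS z)))
         (Num.max (Num.max (- emin (tX z)) 0) (Num.max (- emin (tS z)) 0));
     dual_update := fun _ _ _ y' => slack P y' |}.

Definition interior_method (R : realType) (m n : nat) (P : sdo R m n)
  (N : 'M[R]_n -> R) : ir_method R m n :=
  {| precise := fun e z =>
       [/\ psd (tX z), psd (tS z), N (Cbar P (ty z) (tS z)) <= e,
           maxnorm (bbar P (tX z)) <= e & mxip (tX z) (tS z) <= e];
     refining_precise := fun eta e z zb =>
       [/\ tX zb \is symmetricmx, tS zb \is symmetricmx,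
           psd (tX zb + eta *: tX z) & psd (tS zb + eta *: tS z)] /\
       [/\ N (eta *: Cbar P (ty z) (tS z) - lincomb P (ty zb) - tS zb) <= e,
           forall i,
             `|eta * bbar P (tX z) i 0 - mxip (sdoA P i) (tX zb)| <= e
         & mxip (tX zb + eta *: tX z) (tS zb + eta *: tS z) <= e];
     residual := fun z =>
       Num.max (Num.max (maxnorm (bbar P (tX z))) (mxip (tX z) (tS z)))
         (N (Cbar P (ty z) (tS z)));
     dual_update := fun eta z zb _ => tS z + eta^-1 *: tS zb |}.

Definition ir_update (R : realType) (m n : nat) (M : ir_method R m n) (eta : R)
  (z zb : triple R m n) : triple R m n :=
  let y' := ty z + eta^-1 *: ty zb in
  Triple (tX z + eta^-1 *: tX zb) y' (dual_update M eta z zb y').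

(* [eta k], [z k], [zb k] are the scaling factor, the iterate and the oracle
   answer after k passes through the loop (so [k = 0] is the initial
   one, usually indexed by 1).  A pass is only constrained as long as the loop
   condition [guard] has held so far; entries after the exit are meaningless.
   The oracle is not a function: any precise enough answer may be returned at
   each call. *)
Record ir_run (R : realType) (m n : nat) (M : ir_method R m n) (eps : R)
  (rho : nat) (guard : triple R m n -> bool)
  (eta : nat -> R) (z zb : nat -> triple R m n) : Prop := IRRun {
  ir_run_eta0 : eta 0%N = 1;
  ir_run_init : precise M eps (z 0%N);
  ir_run_pass : forall k, (forall j, (j <= k)%N -> guard (z j)) ->
    [/\ eta k.+1 = Num.min (1 / residual M (z k)) (rho%:R * eta k),
        refining_precise M (eta k) eps (z k) (zb k)
      & z k.+1 = ir_update M (eta k) (z k) (zb k)]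
}.

Definition returns_after (R : realType) (m n : nat)
  (guard : triple R m n -> bool) (z : nat -> triple R m n) (k : nat) : Prop :=
  (forall j, (j < k)%N -> guard (z j)) /\ ~~ guard (z k).

Definition gap_guard (R : realType) (m n : nat) (epst : R) (z : triple R m n) :
  bool := epst < mxip (tX z) (tS z).

Definition residual_guard (R : realType) (m n : nat) (M : ir_method R m n)
  (epst : R) (z : triple R m n) : bool := epst < residual M z.

(* The first clause concerns the loop that stops on the duality gap X . S alone.
   It may stop at an iterate whose other residual terms still exceed epst, so
   epst-optimality of its output needs the residual to be at most epst there.
   The second clause concerns the loop that stops on the whole residual. *)
Definition ir_solves_within (R : realType) (m n : nat) (M : ir_method R m n)
  (eps epst : R) (rho : nat) (bound : R) : Prop :=
  (forall eta z zb, ir_run M eps rho (gap_guard epst) eta z zb ->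
     exists k, [/\ returns_after (gap_guard epst) z k, k%:R <= bound
       & residual M (z k) <= epst -> precise M epst (z k)]) /\
  (forall eta z zb, ir_run M eps rho (residual_guard M epst) eta z zb ->
     exists k, [/\ returns_after (residual_guard M epst) z k, k%:R <= bound
       & precise M epst (z k)]).

(* Main.v *)
Require Import Defs.
From mathcomp Require Import all_boot all_order all_algebra.
From mathcomp Require Import all_classical all_reals all_analysis.
From mathcomp Require Import ring lra zify.

(** The scaling factor is what makes the oracle gain precision.  If a triple
    solves the refining pair at [z] with factor [eta] and precision [eps], then
    every quantity measured at the refined iterate is [1 / eta] times the
    corresponding quantity of the refining pair; the complementarity gap, being
    bilinear, is even divided by [eta ^+ 2].  As [1 <= eta], the refined iterate
    is [(eps / eta)]-precise for the original problem, so its residual is at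
    most [eps / eta].  This is the content of [contracting_method], the only
    part of the argument in which the two methods are distinguished
    ([noninterior_contracting], [interior_contracting]).

    The rest is a growth estimate for the scaling factors [eta k].  The pass that
    produces the iterate of index [k] uses [eta k.-1], so that iterate has residual
    [r <= eps / eta k.-1], and [1 / r >= eta k.-1 / eps].  Hence [eta k.+1] is at
    least [eta k.-1 / eps] or at least [rho * eta k]: measured in powers of
    [1 / eps], two indices gain [1] in the first case, and one index gains [1 / p]
    in the second, because [1 / eps <= rho ^+ p].  For [1 < p] the gain is thus at
    least [1 / p] per index, that is [eps ^- k <= eta k ^+ p]
    ([ir_run_invariant]); an arbitrary [p] may be enlarged to [p.+2].  If the loop
    still goes on at [k], the residual exceeds [epst], so
    [eta k.-1 < eps / epst]; taking logarithms leaves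
    [k.-1 <= p * (ln epst / ln eps - 1)], and the [p >= 2] subtracted here pays
    for the shift from [k.-1] to the [k.+1] passes made by then ([passes_le]).
    At the exit, a residual of at most [epst] is exactly what upgrades an iterate
    of the run to an [epst]-precise solution. *)

Set Implicit Arguments.
Unset Strict Implicit.
Unset Printing Implicit Defensive.

Import Order.TTheory GRing.Theory Num.Theory.
Local Open Scope ring_scope.

(** * Homogeneity of the quantities entering the residual *)

Section InfScaling.
Local Open Scope classical_set_scope.
Context {R : realType}.
Implicit Types (E : set R) (a : R).

Let imageVK E a : 0 < a ->
  [set a^-1 * x | x in [set a * x | x in E]] = E.
Proof.
move=> a0; rewrite image_comp /=; apply/seteqP; split=> [_ [x Ex] <-|x Ex] /=.
  by rewrite mulKf ?gt_eqF.
by exists x => //=; rewrite mulKf ?gt_eqF.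
Qed.

Let infZ_ge E a : 0 < a -> has_inf E ->
  has_inf [set a * x | x in E] /\ a * inf E <= inf [set a * x | x in E].
Proof.
move=> a0 [[x Ex] Elb].
have E0 : [set a * x | x in E] !=set0 by exists (a * x), x.
have Elb' : lbound [set a * x | x in E] (a * inf E).
  by move=> _ [y Ey <-]; rewrite ler_pM2l // ge_inf.
by split; [split=> //; exists (a * inf E) | exact: lb_le_inf].
Qed.

(** Sets without an infimum are covered by the convention that it is [0]. *)
Lemma infZ E a : 0 < a -> inf [set a * x | x in E] = a * inf E.
Proof.
move=> a0; have a'0 : 0 < a^-1 by rewrite invr_gt0.
case: (pselect (has_inf E)) => [Einf|Einf].
  have [aEinf le1] := infZ_ge a0 Einf.
  have [_] := infZ_ge a'0 aEinf; rewrite imageVK // ler_pdivrMl // => le2.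
  by apply/le_anti/andP.
rewrite (inf_out Einf) mulr0 inf_out // => /(infZ_ge a'0)[].
by rewrite imageVK.
Qed.

(** This holds for every square matrix, so that the refined iterates need no
    spectral theory. *)
Lemma eminZ n (U : 'M[R]_n) a : 0 < a -> emin (a *: U) = a * emin U.
Proof.
move=> a0; rewrite /emin -infZ //; congr inf; apply/seteqP; split=> b /=.
  move=> /eigenvalueP[v vU v0]; exists (a^-1 * b); last by rewrite mulVKf ?gt_eqF.
  apply/eigenvalueP; exists v => //.
  by rewrite -scalerA -vU -scalemxAr scalerA mulVf ?gt_eqF // scale1r.
case=> c /eigenvalueP[v vU v0] <-; apply/eigenvalueP; exists v => //.
by rewrite -scalemxAr vU scalerA.
Qed.

End InfScaling.

Section Homogeneity.
Context {R : realType} {m n : nat}.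
Implicit Types (P : sdo R m n) (a e : R) (U V : 'M[R]_n).

Lemma symmetricmx_tr U : reflect (U^T = U) (U \is symmetricmx).
Proof.
rewrite is_hermitianmxE expr0 scale1r map_mx_id //.
by apply: (iffP eqP) => [<-|->]; rewrite ?trmxK.
Qed.

Lemma symmetricmxD a U V :
  U \is symmetricmx -> V \is symmetricmx -> U + a *: V \is symmetricmx.
Proof.
move=> /symmetricmx_tr UT /symmetricmx_tr VT.
by apply/symmetricmx_tr; rewrite linearD linearZ /= UT VT.
Qed.

Lemma psdZ a U : 0 <= a -> psd U -> psd (a *: U).
Proof.
move=> a0 [/symmetricmx_tr UT U0]; split.
  by apply/symmetricmx_tr; rewrite linearZ /= UT.
by move=> x; rewrite -scalemxAr -scalemxAl mxE mulr_ge0.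
Qed.

Lemma mxipZZ a b U V : mxip (a *: U) (b *: V) = a * b * mxip U V.
Proof. by rewrite /mxip -scalemxAl -scalemxAr !mxtraceZ mulrA. Qed.

Lemma lincombD P a y y' : lincomb P (y + a *: y') = lincomb P y + a *: lincomb P y'.
Proof.
rewrite /lincomb scaler_sumr -big_split /=; apply: eq_bigr => i _.
by rewrite !mxE scalerDl scalerA.
Qed.

Lemma maxnorm_le (v : 'cV[R]_m) e :
  0 <= e -> (forall i, `|v i 0| <= e) -> maxnorm v <= e.
Proof. by move=> e0 ve; apply: bigmax_le. Qed.

Lemma addV_scale (V : lmodType R) a (x y : V) :
  a != 0 -> x + a^-1 *: y = a^-1 *: (y + a *: x).
Proof. by move=> a0; rewrite scalerDr scalerA mulVf // scale1r addrC. Qed.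

Lemma bbar_refined P a (X Xb : 'M[R]_n) i : a != 0 ->
  bbar P (X + a^-1 *: Xb) i 0 =
    a^-1 * (a * bbar P X i 0 - mxip (sdoA P i) Xb).
Proof.
move=> a0; rewrite !mxE /mxip mulmxDr linearD /= -scalemxAr mxtraceZ.
by field.
Qed.

Lemma slack_refined P a (y yb : 'cV[R]_m) : a != 0 ->
  slack P (y + a^-1 *: yb) = a^-1 *: (a *: slack P y - lincomb P yb).
Proof.
move=> a0; rewrite /slack lincombD scalerBr scalerA mulVf // scale1r.
by rewrite opprD addrA.
Qed.

Lemma Cbar_refined P a (y yb : 'cV[R]_m) (S Sb : 'M[R]_n) : a != 0 ->
  Cbar P (y + a^-1 *: yb) (S + a^-1 *: Sb) =
    a^-1 *: (a *: Cbar P y S - lincomb P yb - Sb).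
Proof.
move=> a0; rewrite /Cbar lincombD !scalerBr !scalerA mulVf // !scale1r.
by rewrite !opprD !addrA; congr (_ - _); rewrite addrAC.
Qed.

(** The gap is divided by [a ^+ 2], of which only one factor is kept: the other
    quantities are divided by [a] alone. *)
Lemma gap_refined a e U V :
  1 <= a -> 0 <= e -> mxip U V <= e -> mxip (a^-1 *: U) (a^-1 *: V) <= e / a.
Proof.
move=> a1 e0 UVe; have a0 : 0 < a := lt_le_trans ltr01 a1.
have a'0 : 0 <= a^-1 by rewrite invr_ge0 ltW.
have a'1 : a^-1 <= 1 by rewrite invf_le1.
rewrite mxipZZ (le_trans (ler_wpM2l (mulr_ge0 a'0 a'0) UVe)) //.
by rewrite mulrC ler_wpM2l // ler_piMr.
Qed.

End Homogeneity.

(** * Refinement divides the precision by the scaling factor *)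

Section Contraction.
Context {R : realType} {m n : nat}.
Implicit Types (P : sdo R m n) (M : ir_method R m n).

(** What the iteration count needs to know about a method.  The structural
    requirements that carry no tolerance (symmetry, semidefiniteness, the slack
    equation) are hidden inside [precise]; [precise_of_residual] expresses that
    everything else in [precise] is measured by the residual. *)
Record contracting_method M : Prop := ContractingMethod {
  gap_le_residual : forall z, mxip (tX z) (tS z) <= residual M z;
  residual_of_precise : forall e z, 0 <= e -> precise M e z -> residual M z <= e;
  precise_of_residual : forall e e' z,
    precise M e z -> residual M z <= e' -> precise M e' z;
  refined_precise : forall d e a z zb, 0 <= e -> 1 <= a -> precise M d z ->
    refining_precise M a e z zb -> precise M (e / a) (ir_update M a z zb)
}.

Let bbar_small P e a (X Xb : 'M[R]_n) : 0 <= e -> 0 < a ->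
  (forall i, `|a * bbar P X i 0 - mxip (sdoA P i) Xb| <= e) ->
  maxnorm (bbar P (X + a^-1 *: Xb)) <= e / a.
Proof.
move=> e0 a0 be; have a'0 : 0 <= a^-1 by rewrite invr_ge0 ltW.
apply: maxnorm_le => [|i]; first exact: mulr_ge0.
by rewrite bbar_refined ?gt_eqF // normrM ger0_norm // mulrC ler_wpM2r.
Qed.

Let emin_small e a (U : 'M[R]_n) : 0 < a ->
  - e <= emin U -> - (e / a) <= emin (a^-1 *: U).
Proof.
by move=> a0 Ue; rewrite eminZ ?invr_gt0 // mulrC -mulrN ler_pM2l ?invr_gt0.
Qed.

Let noninterior_residual_le (b g x s e : R) :
  (Num.max (Num.max b g) (Num.max (Num.max (- x) 0) (Num.max (- s) 0)) <= e) =
  [&& b <= e, g <= e, 0 <= e, - e <= x & - e <= s].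
Proof.
rewrite !ge_max -!andbA !(lerNl _ e).
by do 2 congr (_ && _); case: (0 <= e); rewrite ?andbT ?andbF.
Qed.

Lemma noninterior_contracting P : contracting_method (noninterior_method P).
Proof.
split.
- by move=> z; rewrite /residual /= !le_max lexx orbT.
- move=> e z e0 [[_ Xe Se] [_ be ge]].
  rewrite [residual _ _]/= noninterior_residual_le.
  by apply/and5P; split.
- move=> e e' z [[Xs _ _] [Sy _ _]].
  rewrite [residual _ _]/= noninterior_residual_le => /and5P[be ge _ Xe Se].
  by split; split.
- move=> d e a z zb e0 a1 [[Xs _ _] _] [[Xbs Xe Sb Se] [be ge]].
  have a0 : 0 < a := lt_le_trans ltr01 a1.
  have aN0 : a != 0 := lt0r_neq0 a0.
  have SE : slack P (ty z + a^-1 *: ty zb) = a^-1 *: tS zb.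
    by rewrite Sb; exact: slack_refined.
  split; split.
  + exact: symmetricmxD.
  + by rewrite [tX _]/= (addV_scale (tX z) _ aN0); exact: emin_small.
  + by rewrite [tS _]/= SE; exact: emin_small.
  + by [].
  + exact: bbar_small.
  + by rewrite [tX _]/= [tS _]/= SE (addV_scale (tX z) _ aN0); exact: gap_refined.
Qed.

Lemma interior_contracting P (N : 'M[R]_n -> R) :
  is_matrix_norm N -> contracting_method (interior_method P N).
Proof.
move=> [_ NZ _]; split=> [z|e z e0|e e' z|d e a z zb e0 a1] /=.
- by rewrite !le_max lexx orbT.
- by case=> _ _ Ce be ge; rewrite !ge_max be ge.
- by case=> Xp Sp _ _ _; rewrite !ge_max => /andP[/andP[be ge] Ce].
- move=> _ [[_ _ Xp Sp] [Ce be ge]].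
  have a0 : 0 < a := lt_le_trans ltr01 a1.
  have a'0 : 0 <= a^-1 by rewrite invr_ge0 ltW.
  have aN0 : a != 0 by rewrite gt_eqF.
  split.
  + by rewrite addV_scale //; exact: psdZ.
  + by rewrite addV_scale //; exact: psdZ.
  + by rewrite Cbar_refined // NZ ger0_norm // mulrC ler_wpM2r.
  + exact: bbar_small.
  + by rewrite !addV_scale // gap_refined.
Qed.

End Contraction.

(** * Counting the passes *)

Section Counting.
Context {R : realType} {m n : nat} (M : ir_method R m n).
Variables (eps epst : R) (rho p : nat) (guard : triple R m n -> bool).
Hypothesis cM : contracting_method M.
Hypotheses (epst0 : 0 < epst) (epst_eps : epst < eps) (eps1 : eps < 1).
Hypotheses (rho1 : (1 < rho)%N) (p2 : (1 < p)%N).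
Hypothesis eps_rho : 1 / eps <= rho%:R ^+ p.
Hypothesis guard_residual : forall z, guard z -> epst < residual M z.
Variables (eta : nat -> R) (z zb : nat -> triple R m n).
Hypothesis run : ir_run M eps rho guard eta z zb.

Let eps0 : 0 < eps. Proof. exact: lt_trans epst_eps. Qed.

(** The new scaling factor [a'] is chosen from the residual [r] of the current
    iterate, which is controlled by the factor [b] of the previous pass, and from
    the factor [a] of the current one; [k] is the index of [a].  Comparing [p]-th
    powers avoids real exponents.  In the branch [1 / r] the exponent of [1 / eps]
    rises from [k.-1] by [p], which makes up for the two indices since [1 < p]. *)
Lemma scaling_growth k (b a r a' : R) : 1 <= b -> 1 <= a ->
  eps ^- k.-1 <= b ^+ p -> eps ^- k <= a ^+ p -> 0 < r -> r <= eps / b ->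
  a' = Num.min (1 / r) (rho%:R * a) -> 1 <= a' /\ eps ^- k.+1 <= a' ^+ p.
Proof.
move=> b1 a1 bk ak r0 rb ->.
have b0 : 0 < b := lt_le_trans ltr01 b1.
have a0 : 0 < a := lt_le_trans ltr01 a1.
have ie0 : 0 <= eps^-1 by rewrite invr_ge0 ltW.
have ie1 : 1 <= eps^-1 by rewrite invf_ge1 // ltW.
have b_r : b / eps <= 1 / r.
  by rewrite -[b / eps]invf_div div1r lef_pV2 ?posrE ?divr_gt0.
have rho_ge1 : (1 : R) <= rho%:R by rewrite ler1n ltnW.
split.
  have b_eps : 1 <= b / eps by exact: mulr_ege1.
  by rewrite le_min (le_trans b_eps b_r) mulr_ege1.
have [_|_] := leP (1 / r) (rho%:R * a).
  apply: (@le_trans _ _ ((b / eps) ^+ p)); last first.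
    by rewrite lerXn2r // nnegrE divr_ge0 // ltW.
  rewrite exprMn -exprVn.
  apply: (@le_trans _ _ (eps^-1 ^+ k.-1 * eps^-1 ^+ p)).
    by rewrite -exprD; apply: ler_weXn2l => //; move: p2; clear; lia.
  by rewrite ler_wpM2r ?exprn_ge0 // exprVn.
rewrite exprMn -exprVn exprS; apply: ler_pM => //.
- by rewrite exprn_ge0.
- by rewrite -div1r.
- by rewrite exprVn.
Qed.

(** At [k = 0] the predecessor is replaced by [0] itself, which is right since
    the first solution is [eps]-precise and the first scaling factor is [1]. *)
Lemma ir_run_invariant k : (forall j, (j < k)%N -> guard (z j)) ->
  [/\ 1 <= eta k.-1, 1 <= eta k, eps ^- k.-1 <= eta k.-1 ^+ p,
      eps ^- k <= eta k ^+ p & precise M (eps / eta k.-1) (z k)].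
Proof.
have [eta0 z0P pass] := run.
elim: k => [|k IH] gk.
  by rewrite /= eta0 expr0 invr1 expr1n mulr1.
have [b1 a1 bk ak zP] := IH (fun j jk => gk j (ltnW jk)).
have [etaE zbP zE] := pass k gk.
have rb : residual M (z k) <= eps / eta k.-1.
  by apply: residual_of_precise => //; rewrite divr_ge0 // ltW // (lt_le_trans _ b1).
have r0 : 0 < residual M (z k).
  by apply: lt_trans (guard_residual (gk k (ltnSn k))).
have [a'1 a'k] := scaling_growth b1 a1 bk ak r0 rb etaE.
split=> //=; rewrite zE.
by apply: refined_precise zP zbP => //; exact: ltW.
Qed.

(** The scaling factor that produced the iterate of index [k] is at least
    [eps ^- k.-1] to the power [1 / p] by growth, and less than [eps / epst]
    because the residual still exceeds [epst]. *)
Lemma passes_le k : (forall j, (j <= k)%N -> guard (z j)) ->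
  k.+1%:R <= p%:R * (ln epst / ln eps).
Proof.
move=> gk; have [b1 _ bk _ zP] := ir_run_invariant (fun j jk => gk j (ltnW jk)).
have b0 : 0 < eta k.-1 := lt_le_trans ltr01 b1.
have epst_r := guard_residual (gk k (leqnn k)).
have rb : residual M (z k) <= eps / eta k.-1.
  by apply: residual_of_precise => //; rewrite divr_ge0 // ltW.
have b_lt : eta k.-1 < eps / epst.
  rewrite ltr_pdivlMr // mulrC -ltr_pdivlMr //; exact: lt_le_trans rb.
have powlt : eps ^- k.-1 <= (eps / epst) ^+ p.
  rewrite (le_trans bk) // lerXn2r ?nnegrE ?(ltW b0) ?(ltW b_lt) //.
  by rewrite divr_ge0 // ltW.
have lne : ln eps < 0 by rewrite ln_lt0 ?eps0.
have : ln (eps ^- k.-1) <= ln ((eps / epst) ^+ p).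
  by rewrite ler_ln ?posrE ?exprn_gt0 ?invr_gt0 ?divr_gt0 ?exprn_gt0.
rewrite lnV ?posrE ?exprn_gt0 // !lnXn ?divr_gt0 // ln_div ?posrE //.
rewrite -[_ *+ k.-1]mulr_natl -[_ *+ p]mulr_natl => lnle.
rewrite mulrA ler_ndivlMr //.
(* The logarithms give [k.-1 <= p * (ln epst / ln eps) - p], and
   [k.+1 <= k.-1 + 2 <= k.-1 + p]. *)
have kE : (k.+1%:R : R) <= k.-1%:R + 2 by rewrite -natrD ler_nat addn2 ltnS leqSpred.
have pE : (2 : R) <= p%:R by rewrite ler_nat.
nra.
Qed.

(** The first index at which the guard fails: its predecessor satisfies the
    guard together with everything before, so [passes_le] bounds the index. *)
Lemma ir_run_returns : exists k, [/\ returns_after guard z k,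
  k%:R <= p%:R * (ln epst / ln eps)
  & residual M (z k) <= epst -> precise M epst (z k)].
Proof.
have [k gk] : exists k, ~~ guard (z k).
  apply: contrapT => /forallNP g; set B : R := p%:R * (ln epst / ln eps).
  have gall j : guard (z j) by apply: contrapT => /negP /g.
  by have := truncnS_gt B; rewrite ltNge (@passes_le (Num.truncn B)) // => j _.
have exg : exists k, ~~ guard (z k) by exists k.
case: (ex_minnP exg) => {gk}k gk kmin.
have gj j : (j < k)%N -> guard (z j).
  by move=> jk; apply: contraTT jk => /kmin; rewrite -leqNgt.
exists k; split=> //; last first.
  by have [_ _ _ _ zP] := ir_run_invariant gj; exact: (precise_of_residual cM zP).
case: k gk kmin gj => [|k] _ _ gj; last exact: passes_le.
have epst1 : epst < 1 := lt_trans epst_eps eps1.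
by rewrite mulr_ge0 // mulr_le0 ?invr_le0 ?ln_le0 // ltW.
Qed.

End Counting.

(** Both loop conditions force the residual above [epst], the gap being one of
    its terms; only the negation of the second one bounds the whole residual. *)
Lemma contracting_solves_within (R : realType) (m n : nat) (M : ir_method R m n)
    (eps epst : R) (rho p : nat) :
  contracting_method M -> 0 < epst -> epst < eps -> eps < 1 ->
  (1 < rho)%N -> (1 < p)%N -> 1 / eps <= rho%:R ^+ p ->
  ir_solves_within M eps epst rho (p%:R * (ln epst / ln eps)).
Proof.
move=> cM epst0 epst_eps eps1 rho1 p2 eps_rho; split=> eta z zb run.
  apply: (ir_run_returns cM epst0 epst_eps eps1 rho1 p2 eps_rho _ run) => y.
  by move=> /lt_le_trans; apply; exact: gap_le_residual.
have [//|k [ret kle prec]] :=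
  ir_run_returns cM epst0 epst_eps eps1 rho1 p2 eps_rho _ run.
by exists k; split=> //; apply: prec; case: ret => _; rewrite -leNgt.
Qed.

(* The constant K hidden in the O depends only on an integer bound p for
   log_rho (1 / eps); every pair (eps, rho) is covered by some p, and p = 1 is
   the regime 1 / eps <= rho. *)
Theorem theorem10 (R : realType) (p : nat) :
  exists K : R, 0 < K /\
  forall (m n : nat) (P : sdo R m n) (z0 : triple R m n)
    (N : 'M[R]_n -> R) (eps epst : R) (rho : nat),
    (0 < n)%N -> sdo_data_ok P -> strong_duality P -> strictly_feasible P z0 ->
    is_matrix_norm N ->
    0 < epst -> epst < eps -> eps < 1 -> (1 < rho)%N ->
    1 / eps <= rho%:R ^+ p ->
    ir_solves_within (noninterior_method P) eps epst rho
      (K * (ln epst / ln eps)) /\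
    ir_solves_within (interior_method P N) eps epst rho
      (K * (ln epst / ln eps)).
Proof.
exists p.+2%:R; split=> // m n P _ N eps epst rho _ _ _ _ normN.
move=> epst0 epst_eps eps1 rho1 eps_rho.
(* Raising the exponent to at least 2 absorbs the delay of one pass with which
   the residual follows the scaling factor. *)
have eps_rho2 : 1 / eps <= rho%:R ^+ p.+2.
  by rewrite (le_trans eps_rho) // ler_weXn2l ?ler1n ?(ltnW rho1) // -addn2 leq_addr.
split; apply: contracting_solves_within => //.
- exact: noninterior_contracting.
- exact: interior_contracting.
Qed.
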